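(* For a compact set $\mathbb{X}\subset\mathbb{R}^d$ of positive Lebesgue measure and a probability measure $Q$ on $\mathbb{R}^d$ having a density $q$ with respect to Lebesgue measure that is bounded above, consider the conditions: (X2) there is $c>0$ such that $|B(x,r)\cap\mathbb{X}|\ge c|B(x,r)|$ for all $x\in\mathbb{X}$ and all $0\le r\le\operatorname{diam}(\mathbb{X})$; (A) $\sup_{L>0}\left\{L^{1/d}\int_{\mathbb{X}}\exp(-L\,\delta(x,\mathbb{X}^c)^d)\,\mathrm dQ(x)\right\}<\infty$. Then (X2) and (A) are both satisfied in either of the following two cases: (i) $\mathbb{X}$ is a compact convex subset of $\mathbb{R}^d$ with non-empty interior; (ii) $\mathbb{X}$ is the closure of a bounded open set and its boundary $\partial\mathbb{X}$ is a $(d-1)$-dimensional submanifold of $\mathbb{R}^d$ of class $C^1$. Furthermore, both conditions are stable under finite unions: if $\mathbb{X}_1,\dots,\mathbb{X}_s$ all satisfy (X2), then so does $\bigcup_{j=1}^s\mathbb{X}_j$; and if $\mathbb{X}_1,\dots,\mathbb{X}_s$ all satisfy (A) with respect to $Q$, then so does $\bigcup_{j=1}^s\mathbb{X}_j$.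
   Context: $|B|$ is the Lebesgue measure of a Borel set $B\subset\mathbb{R}^d$, $B(x,r)$ is the closed Euclidean ball of centre $x$ and radius $r$, and $\delta(x,\mathbb{X}^c)$ is the Euclidean distance from $x$ to $\mathbb{X}^c=\mathbb{R}^d\setminus\mathbb{X}$. *)

(* Defs.v *)
From HB Require Import structures.
From mathcomp Require Import all_boot all_order all_algebra.
From mathcomp Require Import all_classical all_reals all_analysis measurable_realfun.

Set Implicit Arguments.
Unset Strict Implicit.
Unset Printing Implicit Defensive.

Import Order.TTheory GRing.Theory Num.Theory.
Import numFieldNormedType.Exports.

Local Open Scope classical_set_scope.
Local Open Scope ring_scope.

(* R^d is the type 'rV[R]_d. Its library topology comes from the sup norm and  *)
(* is therefore the usual one; measurable sets are the Borel sets.             *)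
HB.instance Definition _ (R : realType) (m n : nat) :=
  @isMeasurable.Build (sigma_display (@open 'M[R]_(m, n))) 'M[R]_(m, n)
    <<s (@open 'M[R]_(m, n)) >>
    (@sigma_algebra0 _ setT (@open 'M[R]_(m, n)))
    (@sigma_algebraC _ (@open 'M[R]_(m, n)))
    (@sigma_algebra_bigcup _ setT (@open 'M[R]_(m, n))).

Section lebesgue_rV.
Context {R : realType}.

Definition rV_cons n (p : measurableTypeR R * 'rV[R]_n) : 'rV[R]_n.+1 :=
  \row_i if unlift ord0 i is Some j then p.2 ord0 j else p.1.

Definition rV_uncons n (v : 'rV[R]_n.+1) : measurableTypeR R * 'rV[R]_n :=
  (v ord0 ord0, \row_j v ord0 (lift ord0 j)).

Lemma rV_consK n : cancel (@rV_cons n) (@rV_uncons n).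
Proof.
move=> [x v]; rewrite /rV_uncons mxE unlift_none; congr pair.
by apply/rowP => j; rewrite !mxE liftK.
Qed.

Lemma open_measurable_mx m n (U : set 'M[R]_(m, n)) : open U -> measurable U.
Proof. exact: sub_sigma_algebra. Qed.

Lemma continuous_measurable_mx m n (f : 'M[R]_(m, n) -> measurableTypeR R) :
  continuous (f : 'M[R]_(m, n) -> R) -> measurable_fun setT f.
Proof.
move=> cf; apply: (measurability _ (RGenOInfty.measurableE R)) => //.
move=> _ [_ [a ->] <-]; rewrite setTI; apply: open_measurable_mx.
by move/continuousP: cf; apply; exact: interval_open.
Qed.

Lemma measurable_rV_uncons n : measurable_fun setT (@rV_uncons n).
Proof.
apply/measurable_fun_pairP; split.
  apply: (@continuous_measurable_mx 1 n.+1 (fun v => v ord0 ord0)).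
  exact: coord_continuous.
apply: (@measurability _ _ _ _ _ _ (@open 'rV[R]_n)) => //.
move=> _ [U oU <-]; rewrite setTI; apply: open_measurable_mx.
suff /continuousP : continuous (snd \o @rV_uncons n) by exact.
move=> v /= A /= /nbhs_ballP[e e0 eA]; apply/nbhs_ballP; exists e => //= w [_ vw].
by apply: eA; split => // i j; rewrite !mxE; exact: vw.
Qed.

Lemma measurable_rV_cons n : measurable_fun setT (@rV_cons n).
Proof.
apply: (@measurability _ _ _ _ _ _ (@open 'rV[R]_n.+1)) => //.
move=> _ [U oU <-]; rewrite setTI.
pose D (i : rat * 'rV[rat]_n * nat) : set (measurableTypeR R * 'rV[R]_n) :=
  ball (ratr i.1.1 : R) i.2.+1%:R^-1 `*`
  ball (map_mx ratr i.1.2 : 'rV[R]_n) i.2.+1%:R^-1.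
pose DU i := if `[< D i `<=` @rV_cons n @^-1` U >] then D i else set0.
rewrite (_ : _ @^-1` _ = \bigcup_i DU i).
  apply: countable_bigcupT_measurable => // i; rewrite /DU; case: ifP => // _.
  apply: measurableX.
    by apply: open_measurable; exact: ball_open.
  by apply: open_measurable_mx; exact: ball_open.
apply/seteqP; split=> [[x v] /= Uxv|p [i _]]; last first.
  by rewrite /DU; case: ifPn => // /asboolP + Dp; exact.
have /nbhs_ballP[e /= e0 eU] : nbhs (rV_cons (x, v)) U.
  by apply: open_nbhs_nbhs.
have [k ke] : exists k : nat, k.+1%:R^-1 < e / 2.
  have e20 : 0 < e / 2 by rewrite divr_gt0.
  have [k _ /(_ k (leqnn k)) kk] := near_infty_natSinv_lt (PosNum e20).
  by exists k.
have k0 : 0 < k.+1%:R^-1 :> R by rewrite invr_gt0.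
have ratP (y : R) : exists r : rat, ball (ratr r : R) k.+1%:R^-1 y.
  have /rat_in_itvoo[r] : y - k.+1%:R^-1 < y + k.+1%:R^-1.
    by rewrite ltrD2l gtrN.
  rewrite in_itv /= => /andP[r1 r2]; exists r.
  rewrite /ball /= ltr_norml; apply/andP; split.
    by rewrite ltrBrDl.
  by rewrite ltrBlDl.
have [r xr] := ratP x; have /choice[w vw] := fun j => ratP (v ord0 j).
exists (r, \row_j w j, k) => //; rewrite /DU ifT.
  split => //=; split=> // i j; rewrite !mxE ord1; exact: vw.
apply/asboolP => -[y u] [/= yr [_ uw]]; apply: eU; split => // i j.
rewrite !mxE; case: unliftP => [l _|_] /=.
- apply: (@le_ball _ _ _ (k.+1%:R^-1 + k.+1%:R^-1)).
    by rewrite [leRHS]splitr; apply: lerD; exact: ltW.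
  apply: ball_triangle (ball_sym (vw l)) _.
  by have := uw ord0 l; rewrite !mxE.
- apply: (@le_ball _ _ _ (k.+1%:R^-1 + k.+1%:R^-1)).
    by rewrite [leRHS]splitr; apply: lerD; exact: ltW.
  exact: ball_triangle (ball_sym xr) yr.
Qed.

HB.instance Definition _ n :=
  isMeasurableFun.Build _ _ _ _ (@rV_cons n) (@measurable_rV_cons n).

Section lebesgue_rVS.
Context n (mu : {sigma_finite_measure set 'rV[R]_n -> \bar R}).

Definition lebesgue_rVS : set 'rV[R]_n.+1 -> \bar R :=
  pushforward (@lebesgue_measure R \x mu)%E (@rV_cons n).

Let lebesgue_rVS0 : lebesgue_rVS set0 = 0%E.
Proof. exact: measure0. Qed.

Let lebesgue_rVS_ge0 A : (0 <= lebesgue_rVS A)%E.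
Proof. exact: measure_ge0. Qed.

Let lebesgue_rVS_sigma_additive : semi_sigma_additive lebesgue_rVS.
Proof. exact: measure_semi_sigma_additive. Qed.

HB.instance Definition _ := isMeasure.Build _ _ _ lebesgue_rVS
  lebesgue_rVS0 lebesgue_rVS_ge0 lebesgue_rVS_sigma_additive.

Let lebesgue_rVS_sigma_finite : sigma_finite setT lebesgue_rVS.
Proof.
have /sigma_finiteP[F [TF ndF Foo]] := sigma_finiteT (@lebesgue_measure R).
have /sigma_finiteP[G [TG ndG Goo]] := sigma_finiteT mu.
exists (fun k => @rV_uncons n @^-1` (F k `*` G k)).
  rewrite -preimage_bigcup [X in _ @^-1` X](_ : _ = setT) ?preimage_setT//.
  rewrite -setXTT TF TG predeqE => -[x y]; split.
    by move=> [k _ []/= ? ?]; split; exists k.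
  move=> [/= [k _ Fkx] [l _ Gly]]; exists (maxn k l) => //; split.
  - by move: x Fkx; exact/subsetPset/ndF/leq_maxl.
  - by move: y Gly; exact/subsetPset/ndG/leq_maxr.
move=> k; have [? ?] := Foo k; have [? ?] := Goo k; split.
  rewrite -[X in measurable X]setTI; apply: measurable_rV_uncons => //.
  exact: measurableX.
rewrite /lebesgue_rVS /pushforward -comp_preimage.
rewrite (_ : _ \o _ = id) ?preimage_id; last exact/funext/rV_consK.
by rewrite product_measure1E// lte_mul_pinfty// ge0_fin_numE.
Qed.

HB.instance Definition _ := Measure_isSigmaFinite.Build _ _ _ lebesgue_rVS
  lebesgue_rVS_sigma_finite.

End lebesgue_rVS.

(* Lebesgue measure on the Borel sets of R^n: the n-fold product of the one-   *)
(* dimensional measure; R^0 is a point, of mass 1.                             *)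
Fixpoint lebesgue_rV n : {sigma_finite_measure set 'rV[R]_n -> \bar R} :=
  if n is n'.+1 then lebesgue_rVS (lebesgue_rV n')
  else dirac (0 : 'rV[R]_0).

Lemma lebesgue_rV_box n (A : 'I_n -> set (measurableTypeR R)) :
  (forall i, measurable (A i)) ->
  (lebesgue_rV n [set v | forall i, A i (v ord0 i)] =
   \prod_(i < n) lebesgue_measure (A i))%E.
Proof.
elim: n A => [A _|n IHn A mA].
  by rewrite big_ord0 /= diracE mem_set// => -[].
rewrite big_ord_recl -IHn; last by move=> i; exact: mA.
rewrite /= /lebesgue_rVS /pushforward.
rewrite (_ : _ @^-1` _ =
    A ord0 `*` [set v : 'rV[R]_n | forall i, A (lift ord0 i) (v ord0 i)]).
  rewrite product_measure1E//.
  rewrite (_ : [set _ | _] = \bigcap_(i in [set: 'I_n])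
      (fun v : 'rV[R]_n => v ord0 i) @^-1` A (lift ord0 i)); last first.
    by apply/seteqP; split=> [v Av i _|v Av i]; [exact: Av|exact: (Av i)].
  apply: fin_bigcap_measurable => // i _.
  rewrite -[X in measurable X]setTI.
  apply: (@continuous_measurable_mx 1 n (fun v => v ord0 i)) => //.
  exact: coord_continuous.
apply/seteqP; split=> [[x v] /= Axv|[x v] [/= Ax Av] i /=].
  split=> /= [|i]; first by have := Axv ord0; rewrite mxE unlift_none.
  by have := Axv (lift ord0 i); rewrite mxE liftK.
by rewrite mxE; case: unliftP => [j|] ->.
Qed.

End lebesgue_rV.

Section conditions.
Context {R : realType} {d : nat}.
Implicit Types (x y : 'rV[R]_d) (r : R) (X : set 'rV[R]_d).

Definition enorm x : R := Num.sqrt (\sum_(i < d) x ord0 i ^+ 2).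

Definition eball x r : set 'rV[R]_d := [set y | enorm (y - x) <= r].

Definition ediam X : R := sup [set enorm (p.1 - p.2) | p in X `*` X].

Definition edist x X : R := inf [set enorm (x - y) | y in X].

Definition boundary X : set 'rV[R]_d := closure X `\` X°.

Definition is_density (Q : probability 'rV[R]_d R) (q : 'rV[R]_d -> R) : Prop :=
  [/\ measurable_fun setT q, forall x, 0 <= q x &
    forall B, measurable B ->
      Q B = (\int[lebesgue_rV d]_(x in B) (q x)%:E)%E].

Definition condX2 X : Prop :=
  exists2 c : R, 0 < c &
    forall x r, X x -> 0 <= r <= ediam X ->
      (c%:E * lebesgue_rV d (eball x r) <= lebesgue_rV d (eball x r `&` X))%E.

Definition condA (Q : probability 'rV[R]_d R) X : Prop :=
  (ereal_sup [set (L `^ d%:R^-1)%:E *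
      \int[Q]_(x in X) (expR (- (L * edist x (~` X) ^+ d)))%:E
    | L in [set L : R | (0 < L)%R]] < +oo)%E.

End conditions.

Definition C1_on (R : realType) m n (U : set 'rV[R]_m)
    (f : 'rV[R]_m -> 'rV[R]_n) : Prop :=
  forall x, U x -> differentiable f x /\ {for x, continuous (jacobian f)}.

(* Total functions f and g stand for a C^1 diffeomorphism from the open set U  *)
(* onto the open set V and its inverse; their values elsewhere are irrelevant. *)
Definition C1_diffeo (R : realType) d (U V : set 'rV[R]_d)
    (f g : 'rV[R]_d -> 'rV[R]_d) : Prop :=
  [/\ open U, open V, (forall x, U x -> V (f x) /\ g (f x) = x),
      (forall y, V y -> U (g y) /\ f (g y) = y) & C1_on U f /\ C1_on V g].

(* Embedded submanifold: around each of its points, some C^1 diffeomorphism    *)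
(* of open sets of R^d straightens S to a piece of R^k x {0}.                  *)
Definition C1_submanifold (R : realType) d (k : nat) (S : set 'rV[R]_d) : Prop :=
  forall p, S p -> exists U V f g,
    [/\ U p, @C1_diffeo R d U V f g &
      f @` (U `&` S) = V `&` [set y | forall i : 'I_d, (k <= i)%N -> y ord0 i = 0]].

(* Main.v *)
Require Import Defs.
From HB Require Import structures.
From mathcomp Require Import all_boot all_order all_algebra.
From mathcomp Require Import all_classical all_reals all_analysis measurable_realfun.
From mathcomp Require Import ring lra.

(** Both cases of the theorem are instances of one geometric property, the
interior cone condition [inner_cone]: near each point [p] of [X] there is a
direction [v] such that, for [x] in [X] close to [p] and small [t >= 0], the
set [X] contains the ball of centre [x + t v] and radius [e t].

- It holds for a convex body, with [v] pointing from [p] to the centre of a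
  ball inside [X] ([convex_inner_cone]).
- It holds for the closure of an open set with a boundary of class C^1
  ([C1_boundary_inner_cone]).  In a straightening chart the boundary is the
  zero set of the last coordinate [phi].  The two halves of a small ball of
  the chart are connected and miss the boundary, so each of them lies in [X]
  or outside [X]; since [p] is a boundary point and [X] is the closure of an
  open set, exactly one of them lies in [X], and [X] is locally
  [{phi >= 0}] or [{phi <= 0}].  By continuity of the derivative, [phi]
  strictly increases along every direction close to a vector [v] with
  [dphi(p) v > 0], which gives the cone.

For a compact [X] the cone condition implies (X2), because [B(x, r) `&` X]
contains a ball of radius comparable to [r] ([inner_cone_X2]).  It also
implies that the part of [X] at distance at most [s] from the complement has
measure [O(s)] ([inner_cone_thin_collar]): locally, the translates of this
part by the multiples of [w = (2 s / e) v] are pairwise disjoint, because a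
point that has moved by at least [w] is at distance at least [2 s] from the
complement; about [1 / s] of these translates fit in a fixed ball, and they all
have the same measure ([lebesgue_rV_translation]).

A collar of measure [O(s)] implies (A) ([thin_collar_condA]): with
[a = L^(1/d)], the integrand is at most [exp(- k)] on the shell where
[k <= a delta <= k + 1], and the measure of this shell is at most a multiple of
[(k + 1) / a]; the same holds for its [Q]-measure, because [Q] has a bounded
density.  The series of general term [(k + 1) exp(- k)] converges.

For unions, (A) is inherited since enlarging the set increases the distance to
the complement.  For (X2), radii between the diameter of a part [X_j] and the
diameter of the union are covered by the fact that the ball then contains all
of [X_j], which has positive measure ([condX2_ball_share]).

Balls are taken in the supremum norm, whose balls are cubes of known measure;
the Euclidean norm is compared with it by [norm_le_enorm] and [enorm_le]. *)

Set Implicit Arguments.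
Unset Strict Implicit.
Unset Printing Implicit Defensive.

Import Order.TTheory GRing.Theory Num.Theory.
Import numFieldNormedType.Exports.

Local Open Scope classical_set_scope.
Local Open Scope ring_scope.

Local Notation edist := Defs.edist.

(** * Norms and Lebesgue measure on row vectors *)

Section euclidean_norm.
Context {R : realType} {d : nat}.
Implicit Types x y : 'rV[R]_d.

Lemma coord_le_norm x i : `|x ord0 i| <= `|x|.
Proof.
rewrite [leRHS]/Num.norm /= mx_normrE.
exact: (@le_bigmax _ _ _ 0 (fun ij : 'I_1 * 'I_d => `|x ij.1 ij.2|) (ord0, i)).
Qed.

Lemma norm_le_enorm x : `|x| <= enorm x.
Proof.
rewrite [leLHS]/Num.norm /= mx_normrE; apply: bigmax_le => [|[i j] _ /=].
  exact: sqrtr_ge0.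
rewrite ord1 -sqrtr_sqr ler_sqrt ?sumr_ge0// => [|k _]; last exact: sqr_ge0.
by rewrite (bigD1 j)//= lerDl sumr_ge0// => k _; exact: sqr_ge0.
Qed.

Lemma enorm_le x : enorm x <= d%:R * `|x|.
Proof.
rewrite -[leRHS]ger0_norm ?mulr_ge0// -sqrtr_sqr ler_sqrt ?sqr_ge0//.
apply: (@le_trans _ _ (\sum_(i < d) `|x| ^+ 2)).
  apply: ler_sum => i _; rewrite -[leLHS]ger0_norm ?sqr_ge0// normrX.
  by rewrite lerXn2r ?nnegrE// coord_le_norm.
rewrite sumr_const card_ord exprMn -[leLHS]mulr_natl; apply: ler_wpM2r.
  exact: sqr_ge0.
by rewrite -natrX ler_nat; case: (d) => // n; exact: leq_pmulr.
Qed.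

Lemma continuous_enorm_sub y : continuous (fun x => enorm (x - y)).
Proof.
move=> x; rewrite /enorm.
apply: (@continuous_comp _ _ _ (fun x => \sum_(i < d) (x - y) ord0 i ^+ 2)
  (@Num.sqrt R)); last exact: sqrt_continuous.
apply: (@continuous_big _ _ +%R 0) => [|i _ {}x]; first exact: add_continuous.
apply: (@continuous_comp _ _ _ (fun x : 'rV[R]_d => (x - y) ord0 i)
  (fun z : R => z ^+ 2)); last exact: exprn_continuous.
rewrite (_ : (fun x => _) = (fun x : 'rV[R]_d => x ord0 i - y ord0 i)).
  apply: (@continuousB _ _ _ (fun x : 'rV[R]_d => x ord0 i) (cst (y ord0 i))).
    exact: coord_continuous.
  exact: cst_continuous.
by apply/funext => z; rewrite !mxE.
Qed.

Lemma closed_eball x r : closed (eball x r).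
Proof.
apply: (@closed_comp _ _ _ [set z : R | z <= r]); last exact: closed_le.
by move=> z _; exact: continuous_enorm_sub.
Qed.

Lemma closed_measurable_rV (A : set 'rV[R]_d) : closed A -> measurable A.
Proof.
move=> cA; rewrite -[A]setCK; apply: measurableC.
by apply: open_measurable_mx; apply: closed_openC.
Qed.

Lemma ball_coordP x r : 0 < r ->
  ball x r = [set v | forall i, ball (x ord0 i) r (v ord0 i)].
Proof.
move=> r0; apply/seteqP; split=> [v [_ xv] i|v xv]; first exact: xv.
by split => // i j; rewrite ord1; exact: xv.
Qed.

End euclidean_norm.

Section lebesgue_measure_rV.
Context {R : realType}.
Local Notation leb := (@lebesgue_rV R _).

Lemma lebesgue_rV_ball d (x : 'rV[R]_d) (r : R) : (0 < d)%N -> 0 <= r ->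
  leb (ball x r) = ((2 * r) ^+ d)%:E.
Proof.
move=> d0; rewrite le_eqVlt => /predU1P[<-|r0].
  rewrite (_ : ball x 0 = set0) ?measure0 ?mulr0 ?expr0n ?gtn_eqF//.
  by apply/seteqP; split=> // v [/=]; rewrite ltxx.
rewrite ball_coordP// (lebesgue_rV_box (A := fun i => ball (x ord0 i) r)).
  under eq_bigr do rewrite lebesgue_measure_ball ?ltW//.
  rewrite prodEFin; congr (_%:E).
  by rewrite prodr_const card_ord mulr_natl.
by move=> i; exact: measurable_ball.
Qed.

Lemma lebesgue_rV_eball_le d (x : 'rV[R]_d) (r : R) : 0 <= r ->
  (leb (eball x r) <= ((2 * r) ^+ d)%:E)%E.
Proof.
move=> r0.
pose B := [set v : 'rV[R]_d | forall i, v ord0 i \in `[x ord0 i - r, x ord0 i + r]].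
have mB : measurable B.
  rewrite (_ : B = \bigcap_(i in [set: 'I_d])
      (fun v : 'rV[R]_d => v ord0 i) @^-1` `[x ord0 i - r, x ord0 i + r]).
    apply: fin_bigcap_measurable => // i _.
    rewrite -[X in measurable X]setTI.
    apply: (@continuous_measurable_mx R 1 d (fun v => v ord0 i)) => //.
    exact: coord_continuous.
  by apply/seteqP; split=> [v Bv i _|v Bv i]; [exact: Bv|exact: (Bv i)].
apply: (@le_trans _ _ (leb B)).
  apply: le_measure; rewrite ?inE//.
    by apply: closed_measurable_rV; exact: closed_eball.
  move=> v xv i; rewrite /= in_itv /= -ler_distlC.
  apply: le_trans (le_trans (norm_le_enorm _) xv).
  by have := coord_le_norm (v - x) i; rewrite !mxE distrC.
rewrite (lebesgue_rV_box (A := fun i => `[x ord0 i - r, x ord0 i + r]%classic))//.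
rewrite (eq_bigr (fun=> (2 * r)%:E)) => [|i _].
  by rewrite prodEFin prodr_const card_ord.
rewrite lebesgue_measure_itv /= lte_fin.
case: ifPn => [_|]; first by rewrite -EFinD; congr (_%:E); ring.
rewrite -leNgt => ?; congr (_%:E); apply/eqP; rewrite eq_le; apply/andP; split; lra.
Qed.

Lemma continuous_translation d (v : 'rV[R]_d) : continuous (+%R v).
Proof.
by move=> x; apply: (@continuousD _ _ _ (cst v) id) => //; exact: cst_continuous.
Qed.

Lemma measurable_translation d (v : 'rV[R]_d) : measurable_fun setT (+%R v).
Proof.
apply: (@measurability _ _ _ _ _ _ (@open 'rV[R]_d)) => //.
move=> _ [U oU <-]; rewrite setTI; apply: open_measurable_mx.
by apply: open_comp => // x _; exact: continuous_translation.
Qed.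

Lemma measurable_translation1 (a : R) :
  measurable_fun setT (+%R a : measurableTypeR R -> measurableTypeR R).
Proof. exact: measurable_funD. Qed.

(** Lebesgue measure on the line is determined by its values on intervals. *)
Lemma lebesgue_measure_translation (a : R) (A : set (measurableTypeR R)) :
  measurable A -> lebesgue_measure (+%R a @^-1` A) = lebesgue_measure A.
Proof.
move=> mA; apply/esym; have mT := measurable_translation1 a.
pose T : {mfun measurableTypeR R >-> measurableTypeR R} :=
  HB.pack (+%R a : measurableTypeR R -> measurableTypeR R)
    (isMeasurableFun.Build _ _ _ _ _ mT).
apply: (lebesgue_measure_unique (mu := pushforward lebesgue_measure T)) => //=.
move=> _ [[b c]] _ <-.
rewrite /pushforward (_ : _ @^-1` _ = `](b - a), (c - a)]%classic).
  rewrite !lebesgue_measure_itv/= !lte_fin ltrD2r; case: ifPn => // _.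
  by rewrite -!EFinD; congr (_%:E); ring.
by apply/seteqP; split=> x /=; rewrite !in_itv /= ltrBlDl lerBrDl.
Qed.

(** By induction on the dimension, translating after [rV_cons] is the product
of a translation of the line and one of the lower-dimensional space; a measure
that agrees with the product measure on rectangles is equal to it. *)
Lemma lebesgue_rV_translation d (v : 'rV[R]_d) (A : set 'rV[R]_d) :
  measurable A -> leb (+%R v @^-1` A) = leb A.
Proof.
elim: d v A => [|d IHd] v A mA.
  rewrite (_ : _ @^-1` _ = A)//.
  have E x : v + x = x by apply/rowP => -[].
  by apply/seteqP; split=> x /=; rewrite E.
pose T (p : measurableTypeR R * 'rV[R]_d) : measurableTypeR R * 'rV[R]_d :=
  (v ord0 ord0 + p.1, (rV_uncons v).2 + p.2).
have mT : measurable_fun setT T.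
  apply/measurable_fun_pairP; split.
    exact: measurable_funD.
  by apply: (measurableT_comp (@measurable_translation _ _)).
pose T' : {mfun (measurableTypeR R * 'rV[R]_d)%type >->
                (measurableTypeR R * 'rV[R]_d)%type} :=
  HB.pack T (isMeasurableFun.Build _ _ _ _ T mT).
have mA' : measurable (@rV_cons R d @^-1` A).
  by rewrite -[X in measurable X]setTI; exact: measurable_rV_cons.
have TE : @rV_cons R d @^-1` (+%R v @^-1` A) = T' @^-1` (@rV_cons R d @^-1` A).
  have E p : v + rV_cons p = rV_cons (T p).
    by apply/rowP => i; rewrite !mxE; case: unliftP => [j|] -> /=; rewrite ?mxE.
  by apply/seteqP; split=> p /=; rewrite E.
rewrite /= /lebesgue_rVS {1}/pushforward TE; apply/esym.
apply: (product_measure_unique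
  (m' := pushforward (lebesgue_measure \x lebesgue_rV d)%E T')) => // B C mB mC.
transitivity ((lebesgue_measure \x lebesgue_rV d)%E
    ((+%R (v ord0 ord0) @^-1` B) `*` (+%R (rV_uncons v).2 @^-1` C))) => //.
rewrite product_measure1E//.
- by congr (_ * _)%E; [exact: lebesgue_measure_translation|exact: IHd].
- by rewrite -[X in measurable X]setTI; apply: measurable_translation1.
- by rewrite -[X in measurable X]setTI; exact: measurable_translation.
Qed.

End lebesgue_measure_rV.

(** * The interior cone condition, balls and collars *)

(** Otherwise the sets [A] such that [P (X `\` A)] would form a proper filter
containing [X]; at one of its cluster points [P] would fail locally.  This
replaces the extraction of a finite subcover. *)
Lemma compact_local_union (T : topologicalType) (X : set T)
    (P : set T -> Prop) :
  P set0 -> (forall A B, A `<=` B -> P B -> P A) ->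
  (forall A B, P A -> P B -> P (A `|` B)) ->
  (forall p, X p -> exists2 U, nbhs p U & P (X `&` U)) ->
  compact X -> P X.
Proof.
move=> P0 sP UP lP cX; apply: contrapT => nPX.
pose F : set_system T := [set A | P (X `\` A)].
have FF : ProperFilter F.
  split; first by rewrite /F/= setD0.
  split; rewrite /F /=.
  - by rewrite setDT.
  - by move=> A B PA PB; rewrite /= setDIr; exact: UP.
  - by move=> A B AB; apply: sP; exact: setDS.
have FX : F X by rewrite /F/= setDv.
have [p [Xp clp]] := cX F FF FX.
have [U pU PU] := lP p Xp.
have [q [/= nUq Uq]] : ~` U `&` U !=set0.
  by apply: clp => //; rewrite /F/= setDE setCK.
exact: nUq.
Qed.

(** The constants and the direction [v] are uniform in [x] near [p], which is
what the compactness arguments need.  At [t = 0] the ball is empty. *)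
Definition inner_cone (R : realType) d (X : set 'rV[R]_d) (p : 'rV[R]_d) :=
  exists U (v : 'rV[R]_d) (e T : R), [/\ nbhs p U, 0 < e, 0 < T &
    forall x t, X x -> U x -> 0 <= t <= T -> ball (x + t *: v) (e * t) `<=` X].

Section cone.
Context {R : realType} {d : nat}.
Context (d_gt0 : (0 < d)%N).
Implicit Types (X : set 'rV[R]_d) (p : 'rV[R]_d).

(** Condition (X2) for [Y] is [ball_share Y (ediam Y) Y].  Separating the set
[A] of centres from [Y] gives a property that is stable under unions in [A],
hence one that can be proved locally or piece by piece. *)
Definition ball_share (Y : set 'rV[R]_d) (D : R) (A : set 'rV[R]_d) :=
  exists2 c : R, 0 < c & forall x r, A x -> 0 <= r <= D ->
    (c%:E * lebesgue_rV d (eball x r) <= lebesgue_rV d (eball x r `&` Y))%E.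

Lemma ball_share0 Y D : ball_share Y D set0.
Proof. by exists 1. Qed.

Lemma ball_shareS Y D A B : A `<=` B -> ball_share Y D B -> ball_share Y D A.
Proof. by move=> AB [c c0 Bc]; exists c => // x r /AB; exact: Bc. Qed.

Lemma ball_shareU Y D A B : ball_share Y D A -> ball_share Y D B ->
  ball_share Y D (A `|` B).
Proof.
move=> [a a0 Aa] [b b0 Bb]; exists (Num.min a b); first by rewrite lt_min a0.
move=> x r [Ax|Bx] rD.
  by apply: le_trans (Aa x r Ax rD); rewrite lee_wpmul2r// lee_fin ge_min lexx.
apply: le_trans (Bb x r Bx rD).
by rewrite lee_wpmul2r// lee_fin ge_min lexx orbT.
Qed.

Lemma compact_measurable_rV X : compact X -> measurable X.
Proof.
by move=> cX; apply: closed_measurable_rV; exact: compact_closed.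
Qed.

(** If [t = c0 * r] with [c0] small, the cone ball of centre [x + t v] and
radius [e t] is contained in the Euclidean ball of centre [x] and radius [r],
and its measure is a fixed fraction of [(2 r)^d]. *)
Lemma inner_cone_X2 X : compact X -> (forall p, X p -> inner_cone X p) ->
  condX2 X.
Proof.
move=> cX coneX; pose D := ediam X; have mX := compact_measurable_rV cX.
suff : ball_share X D X by [].
apply: (@compact_local_union _ X (ball_share X D)) => //.
- exact: ball_share0.
- by move=> A B; exact: ball_shareS.
- by move=> A B; exact: ball_shareU.
move=> p Xp; have [U [v [e [T [pU e0 T0 coneU]]]]] := coneX p Xp.
exists U => //.
pose m := d%:R * (`|v| + e).
have m0 : 0 < m by rewrite mulr_gt0 ?ltr0n// ltr_wpDl.
(* The first bound keeps the cone ball inside [eball x r]; the second one keeps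
   [c0 * r] below [T] for all [r <= D], also when [D = 0]. *)
pose c0 := Num.min m^-1 (T / (`|D| + 1)).
have c00 : 0 < c0.
  by rewrite lt_min invr_gt0 m0 divr_gt0// ltr_wpDl.
exists ((e * c0) ^+ d); first by rewrite exprn_gt0// mulr_gt0.
move=> x r [Xx Ux] /andP[r0 rD].
have t0 : 0 <= c0 * r by rewrite mulr_ge0// ltW.
have tT : c0 * r <= T.
  apply: (@le_trans _ _ (T / (`|D| + 1) * r)).
    by rewrite ler_wpM2r// ge_min lexx orbT.
  rewrite -mulrA ger_pMr// mulrC ler_pdivrMr ?ltr_wpDl// mul1r.
  by rewrite (le_trans rD)// (le_trans (ler_norm _))// lerDl.
have tm : c0 * r * m <= r.
  rewrite mulrAC ler_piMl// -ler_pdivlMr// mul1r.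
  by rewrite ge_min lexx.
apply: (@le_trans _ _ (lebesgue_rV d (ball (x + (c0 * r) *: v) (e * (c0 * r))))).
  rewrite lebesgue_rV_ball// ?mulr_ge0 ?(ltW e0) ?(ltW c00)//.
  apply: (le_trans (lee_wpmul2l _ (lebesgue_rV_eball_le x r0))).
    by rewrite lee_fin exprn_ge0// mulr_ge0 ?ltW.
  by rewrite -EFinM -exprMn (_ : e * c0 * (2 * r) = 2 * (e * (c0 * r)))//; ring.
apply: le_measure; rewrite ?inE.
- by apply: open_measurable_mx; exact: ball_open.
- by apply: measurableI => //; apply: closed_measurable_rV; exact: closed_eball.
move=> y xy; split; last by apply: (coneU x (c0 * r)) => //; rewrite t0.
rewrite /eball /=; apply: le_trans (enorm_le _) _; apply: le_trans tm.
rewrite /m mulrCA ler_pM2l ?ltr0n//.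
move: xy; rewrite -ball_normE/= distrC => xy.
rewrite (_ : y - x = (c0 * r) *: v + (y - (x + (c0 * r) *: v))).
  apply: (le_trans (ler_normD _ _)).
  rewrite normrZ ger0_norm// mulrDr lerD2l.
  by apply: (le_trans (ltW xy)); rewrite mulrC.
by apply/rowP => i; rewrite !mxE; ring.
Qed.

Lemma le_edist_ball X y r : ~` X !=set0 -> ball y r `<=` X -> r <= edist y (~` X).
Proof.
move=> [z nXz] yrX; apply: lb_le_inf; first by exists (enorm (y - z)), z.
move=> _ [w nXw <-]; rewrite leNgt; apply/negP => yw; apply: nXw; apply: yrX.
by rewrite -ball_normE /=; apply: le_lt_trans yw; exact: norm_le_enorm.
Qed.

Lemma edist_ge0 (S : set 'rV[R]_d) x : 0 <= edist x S.
Proof.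
have [[z Sz]|/set0P/negP/negPn/eqP->] := pselect (S !=set0); last first.
  by rewrite /edist image_set0 inf0.
apply: lb_le_inf; first by exists (enorm (x - z)), z.
by move=> _ [w _ <-]; exact: sqrtr_ge0.
Qed.

Lemma compact_setC_nonempty X : compact X -> ~` X !=set0.
Proof.
move=> /compact_bounded[M [Mreal XM]].
have M1 : M < `|M| + 1 by rewrite (le_lt_trans (ler_norm M))// ltrDl.
(* This vector has norm greater than [`|M| + 1] because there is a coordinate. *)
exists (const_mx (`|M| + 2)) => /(XM _ M1) /= leM.
have := coord_le_norm (const_mx (`|M| + 2) : 'rV[R]_d) (Ordinal d_gt0).
rewrite mxE => /le_trans/(_ leM)/(le_trans (ler_norm _)).
by rewrite lerD2l (_ : 2 <= 1 = false)//; apply/negbTE; rewrite -ltNge ltr1n.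
Qed.

(** The set where the distance is less than [a] is a union of open balls, so
the distance is upper semicontinuous. *)
Lemma measurable_edist X : measurable_fun setT
  (fun x => edist x X : measurableTypeR R).
Proof.
have [[z Xz]|/set0P/negP/negPn/eqP->] := pselect (X !=set0); last first.
  rewrite (_ : (fun x => _) = cst (0 : R)); first exact: measurable_cst.
  by apply/funext => x; rewrite /edist image_set0 inf0.
apply: (measurability _ (RGenInftyO.measurableE R)) => //.
move=> _ [_ [a ->] <-]; rewrite setTI; apply: open_measurable_mx.
rewrite (_ : _ @^-1` _ = \bigcup_(w in X) [set x | enorm (x - w) < a]).
  apply: bigcup_open => w _.
  apply: (@open_comp _ _ (fun x : 'rV[R]_d => enorm (x - w)) [set t : R | t < a]).
    by move=> x _; exact: continuous_enorm_sub.
  exact: open_lt.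
apply/seteqP; split=> x /=; rewrite in_itv /=.
  move=> /inf_lt[|_ [w Xw <-] xwa]; first by exists (enorm (x - z)), z.
  by exists w.
move=> [w Xw xwa]; apply: le_lt_trans xwa; apply: ge_inf; last by exists w.
by exists 0 => _ [u _ <-]; exact: sqrtr_ge0.
Qed.

(** The translates of [N] by the multiples [k w], [k < n], are pairwise
disjoint, have the measure of [N], and lie in a ball of measure [(2 M)^d]. *)
Lemma packing_translates (N : set 'rV[R]_d) (w : 'rV[R]_d) (n : nat) (M : R) :
  measurable N -> 0 <= M ->
  (forall x k, N x -> (k < n)%N -> ball 0 M (x + k%:R *: w)) ->
  (forall x k, N x -> (0 < k < n)%N -> ~ N (x + k%:R *: w)) ->
  (n%:R%:E * lebesgue_rV d N <= ((2 * M) ^+ d)%:E)%E.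
Proof.
move=> mN M0 NM Ndisj.
pose F (k : 'I_n) := +%R (- (k%:R *: w)) @^-1` N.
have mF k : measurable (F k).
  by rewrite -[X in measurable X]setTI; exact: measurable_translation.
have tF : trivIset setT F.
  have F0 (i j : 'I_n) y : (i < j)%N -> F i y -> ~ F j y.
    move=> ij Fi Fj; apply: (Ndisj _ (j - i)%N Fj).
      by rewrite subn_gt0 ij /= (leq_ltn_trans (leq_subr _ _)).
    rewrite (_ : - (j%:R *: w) + y + _ = - (i%:R *: w) + y)//.
    rewrite natrB 1?ltnW// scalerBl addrCA addrA.
    by apply/rowP => l; rewrite !mxE; ring.
  apply/trivIsetP => i j _ _ ij; apply/seteqP; split => // y [Fi Fj].
  case: (ltngtP i j) => [ltij|ltji|/val_inj eij].
  - exact: (F0 i j y).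
  - exact: (F0 j i y).
  - by rewrite eij eqxx in ij.
rewrite -(lebesgue_rV_ball 0 d_gt0 M0).
apply: (@le_trans _ _ (lebesgue_rV d (\big[setU/set0]_(k < n) F k))).
  rewrite measure_bigsetU_ord// (eq_bigr (fun=> lebesgue_rV d N)).
    by rewrite sumr_const card_ord mule_natl.
  by move=> k _; exact: lebesgue_rV_translation.
apply: le_measure; rewrite ?inE.
- exact: bigsetU_measurable.
- by apply: open_measurable_mx; exact: ball_open.
- apply: (big_ind (fun A => A `<=` ball 0 M)) => // [A B AM BM|k _ y Fk].
    by rewrite subUset.
  have := NM _ k Fk (ltn_ord k).
  by rewrite addrAC addNr add0r.
Qed.

Definition thin_collar (X : set 'rV[R]_d) :=
  exists2 C : R, 0 <= C & forall s : R, 0 < s ->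
  (lebesgue_rV d (X `&` [set x | (edist x (~` X) <= s)%R]) <= (C * s)%:E)%E.

Lemma measurable_sublevel_edist X s : measurable X ->
  measurable (X `&` [set x | edist x (~` X) <= s]).
Proof.
move=> mX; apply: measurableI => //.
rewrite (_ : [set x | _] = (fun x => edist x (~` X)) @^-1` `]-oo, s]).
  rewrite -[X in measurable X]setTI.
  exact: (@measurable_edist (~` X)).
by apply/seteqP; split=> x /=; rewrite in_itv.
Qed.

(** The local version bounds a measurable superset, since the sets that occur
in [compact_local_union] are arbitrary. *)
Lemma inner_cone_thin_collar X : compact X ->
  (forall p, X p -> inner_cone X p) -> thin_collar X.
Proof.
move=> cX coneX.
have mX := compact_measurable_rV cX.
have nX := compact_setC_nonempty cX.
pose N s := X `&` [set x | edist x (~` X) <= s].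
have mN s : measurable (N s) by exact: measurable_sublevel_edist.
pose P A := exists2 C : R, 0 <= C & forall s, 0 < s ->
  exists B, [/\ measurable B, N s `&` A `<=` B &
             (lebesgue_rV d B <= (C * s)%:E)%E].
suff [C C0 XC] : P X.
  exists C => // s /XC[B [mB NB]]; apply: le_trans; apply: le_measure; rewrite ?inE//.
    exact: mN.
  by move=> x /[dup] Nx [Xx _]; apply: NB.
apply: (@compact_local_union _ X P) => //.
- by exists 0 => // s s0; exists set0; split; rewrite ?setI0 ?measure0 ?mul0r.
- move=> A B AB [C C0 BC]; exists C => // s /BC[E [mE NE EC]]; exists E; split => //.
  by apply: subset_trans NE; exact: setIS.
- move=> A B [C1 C10 AC] [C2 C20 BC]; exists (C1 + C2); first exact: addr_ge0.
  move=> s s0; have [E [mE NE EC]] := AC s s0; have [F [mF NF FC]] := BC s s0.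
  exists (E `|` F); split; first exact: measurableU.
    by rewrite setIUr; exact: setUSS.
  by rewrite mulrDl EFinD; apply: le_trans (measureU2 _ mE mF) _; exact: leeD.
move=> p Xp; have [U [v [e [T [pU e0 T0 coneU]]]]] := coneX p Xp.
exists U° ; first exact: nbhs_interior.
have /compact_bounded[M0 [M0real XM0]] := cX.
have {}XM0 x : X x -> `|x| <= `|M0| + 1.
  by apply: XM0; rewrite (le_lt_trans (ler_norm M0))// ltrDl.
pose M := `|M0| + 1 + T * `|v| + 1.
have M_ge0 : 0 <= M by rewrite !addr_ge0// mulr_ge0// ltW.
pose C0 := (2 * M) ^+ d.
exists (C0 * (2 / (e * T))).
  by rewrite mulr_ge0 ?exprn_ge0 ?divr_ge0 ?mulr_ge0// ltW.
move=> s s0; exists (N s `&` U°); split.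
- by apply: measurableI => //; apply: open_measurable_mx; exact: open_interior.
- by rewrite setICA; exact: subIsetr.
(* Moving by [k * tau] along [v], [k >= 1], brings a point of [X] to distance
   at least [e * tau = 2 * s] from the complement; [n] is the number of
   translates for which the motion stays within the range [0, T]. *)
pose tau := 2 * s / e.
have tau0 : 0 < tau by rewrite divr_gt0 ?mulr_gt0.
pose n := (Num.Def.trunc (T / tau)).+1.
have nT k : (k < n)%N -> k%:R * tau <= T.
  by rewrite ltnS -ler_pdivlMr// -truncn_ge_nat// divr_ge0// ltW.
have Tn : T < n%:R * tau.
  by rewrite -ltr_pdivrMr// truncnS_gt.
suff : (n%:R%:E * lebesgue_rV d (N s `&` U°) <= C0%:E)%E.
  rewrite -lee_pdivlMl ?ltr0n// => /le_trans; apply.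
  rewrite -EFinM lee_fin mulrC -mulrA ler_wpM2l ?exprn_ge0 ?mulr_ge0//.
  rewrite -div1r ler_pdivrMr ?ltr0n//.
  rewrite (_ : _ * _ * _ = n%:R * tau / T); last first.
    by rewrite /tau; field; rewrite !gt_eqF.
  by rewrite ler_pdivlMr// mul1r ltW.
apply: (@packing_translates _ (tau *: v)) => //.
- by apply: measurableI => //; apply: open_measurable_mx; exact: open_interior.
- move=> x k [[Xx _] _] /nT kT.
  rewrite -ball_normE/= sub0r normrN (le_lt_trans (ler_normD _ _))// /M.
  rewrite (@le_lt_trans _ _ (`|M0| + 1 + T * `|v|)) ?ltrDl// lerD ?XM0//.
  rewrite scalerA normrZ ger0_norm; first by rewrite ler_wpM2r ?kT.
  by rewrite mulr_ge0// ltW.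
- move=> x k [[Xx _] /interior_subset Ux] /andP[k0 /nT kT] [[_ /= +] _].
  apply/negP; rewrite -ltNge scalerA.
  apply: (@lt_le_trans _ _ (e * (k%:R * tau))).
    rewrite /tau (_ : e * _ = k%:R * (2 * s)); last by field; rewrite gt_eqF.
    by rewrite mulrA ltr_pMl// -natrM ltr1n muln2 -[2%N]/1.*2%N leq_double.
  apply: le_edist_ball => //; apply: coneU => //.
  by rewrite kT mulr_ge0 ?(ltW tau0).
Qed.

End cone.

(** * From thin collars to condition (A) *)

Section exponential_moment.
Context {R : realType} {d : nat}.
Context (d_gt0 : (0 < d)%N).
Implicit Types (X : set 'rV[R]_d).

Lemma density_le (Q : probability 'rV[R]_d R) (q : 'rV[R]_d -> R) (M : R)
    (B : set 'rV[R]_d) :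
  is_density Q q -> (forall x, q x <= M) -> measurable B ->
  (Q B <= M%:E * lebesgue_rV d B)%E.
Proof.
move=> [mq q0 QE] qM mB; rewrite (QE _ mB) -integral_cst//.
apply: ge0_le_integral => //.
- by move=> x _; rewrite lee_fin.
- by apply/measurable_EFinP; exact: measurable_funS mq.
- by move=> x _; rewrite lee_fin.
Qed.

(** Split [exp(- k)] as [exp(- k / 2)^2] and use [exp(k / 2) >= 1 + k / 2]. *)
Lemma expR_decay_le_geometric (k : nat) :
  k.+1%:R * expR (- k%:R) <= 2 * expR (- 2^-1) ^+ k :> R.
Proof.
rewrite -expRM_natl mulrN.
have -> : - k%:R = - (k%:R * 2^-1) + - (k%:R * 2^-1) :> R by field.
rewrite expRD mulrA ler_wpM2r ?expR_ge0// expRN ler_pdivrMr ?expR_gt0//.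
apply: (@le_trans _ _ (2 * (1 + k%:R * 2^-1))).
  by rewrite mulrDr mulr1 mulrCA mulfV// mulr1 -natr1 addrC lerD2r ler1n.
by rewrite ler_wpM2l// expR_ge1Dx.
Qed.

Lemma geometric_nneseries_le (a z : R) : 0 <= a -> 0 <= z < 1 ->
  (\sum_(0 <= k <oo) (a * z ^+ k)%:E <= (a / (1 - z))%:E)%E.
Proof.
move=> a0 /andP[z0 z1].
have u0 k : (0 <= (a * z ^+ k)%:E)%E by rewrite lee_fin mulr_ge0// exprn_ge0.
apply: lime_le; first exact: is_cvg_nneseries.
apply: nearW => n; rewrite sumEFin lee_fin.
have -> : \sum_(0 <= k < n) a * z ^+ k = a * (1 - z ^+ n) / (1 - z).
  rewrite -[LHS]/(series (geometric a z) n) geometric_seriesE//.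
  by rewrite lt_eqF.
rewrite ler_wpM2r ?invr_ge0 ?subr_ge0 ?(ltW z1)//.
by rewrite ler_piMr// gerBl exprn_ge0.
Qed.

(** The term of index [k = floor u] suffices: either [k = 0], or [u >= 1] and
then [u ^ d >= u >= k]. *)
Lemma expR_pow_le_shells (u : R) : 0 <= u ->
  ((expR (- u ^+ d))%:E <=
   \sum_(0 <= k <oo) (expR (- k%:R))%:E * ((u <= k.+1%:R)%R%:R)%:E)%E.
Proof.
move=> u0; pose k := Num.Def.trunc u.
have f0 n : (0 <= (expR (- n%:R))%:E * ((u <= n.+1%:R)%R%:R)%:E :> \bar R)%E.
  by rewrite -EFinM lee_fin mulr_ge0// expR_ge0.
apply: le_trans (@nneseries_lim_ge _ _ xpredT _ k.+1 _) => //.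
rewrite big_nat_recr//= -[leLHS]add0e leeD ?sume_ge0//.
have /andP[ku uk] := truncn_itv u0.
rewrite -EFinM lee_fin (ltW uk) mulr1 ler_expR lerN2.
move: ku; rewrite -/k; case: k => [_|k ku]; first exact: exprn_ge0.
apply: le_trans (ku) _; rewrite -[leLHS]expr1 ler_weXn2l//.
by apply: le_trans ku; rewrite ler1n.
Qed.

Lemma measurable_exp_edist X (D : set 'rV[R]_d) (L : R) : measurable D ->
  measurable_fun D (fun x => (expR (- (L * edist x (~` X) ^+ d)))%:E).
Proof.
move=> mD; apply/measurable_EFinP; apply: measurableT_comp => //.
apply: measurableT_comp => //; apply: measurable_funM => //.
apply: measurable_funX; apply: measurable_funS (@measurable_edist _ _ (~` X)) => //.
Qed.

(** Bound the integrand by the sum over [k] of [exp(- k)] times the indicator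
of the collar of width [(k + 1) / a], where [a = L^(1/d)]; the factor [1 / a]
in the measure of this collar cancels the factor [L^(1/d)] of (A). *)
Lemma thin_collar_condA (Q : probability 'rV[R]_d R) (q : 'rV[R]_d -> R) X :
  is_density Q q -> (exists M : R, forall x, q x <= M) ->
  measurable X -> thin_collar X -> condA Q X.
Proof.
move=> Qq [M qM] mX [C C0 XC].
have M0 : 0 <= M by have [_ q0 _] := Qq; exact: le_trans (q0 0) (qM 0).
pose z : R := expR (- 2^-1).
have z0 : 0 <= z by exact: expR_ge0.
have z1 : z < 1 by rewrite expR_lt1 oppr_lt0 invr_gt0.
apply: (@le_lt_trans _ _ (2 * (M * C) / (1 - z))%:E); last exact: ltry.
apply: ge_ereal_sup => _ [L /= L0 <-].
pose a := L `^ d%:R^-1.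
have a0 : 0 < a by exact: powR_gt0.
have aL : a ^+ d = L.
  rewrite -powR_mulrn ?ltW// -powRrM mulVf ?powRr1 ?ltW//.
  by rewrite pnatr_eq0 -lt0n.
pose dist x := edist x (~` X).
pose A k := X `&` [set x | dist x <= k.+1%:R / a].
have mA k : measurable (A k) by exact: measurable_sublevel_edist.
have QA k : (Q (A k) <= (M * C * (k.+1%:R / a))%:E)%E.
  apply: le_trans (density_le Qq qM (mA k)) _.
  rewrite -mulrA EFinM lee_wpmul2l ?lee_fin//; apply: XC.
  by rewrite divr_gt0// ltr0n.
pose f k x := ((expR (- k%:R))%:E * (\1_(A k) x)%:E)%E : \bar R.
have f0 k x : X x -> (0 <= f k x)%E.
  by move=> _; rewrite /f -EFinM lee_fin mulr_ge0// expR_ge0.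
have mf k : measurable_fun X (f k).
  apply: emeasurable_funM => //.
  apply/measurable_EFinP; exact: measurable_indic.
have le_int : (\int[Q]_(x in X) (expR (- (L * dist x ^+ d)))%:E <=
    \sum_(0 <= k <oo) (expR (- k%:R))%:E * Q (A k))%E.
  apply: (@le_trans _ _ (\int[Q]_(x in X) (\sum_(0 <= k <oo) f k x))%E).
    apply: ge0_le_integral => //.
    - exact: (measurable_exp_edist _ _ mX).
    - by apply: ge0_emeasurable_sum => // k x + _; exact: f0.
    - move=> x Xx; rewrite -aL -exprMn.
      have u0 : 0 <= a * dist x.
        by apply: mulr_ge0 (ltW a0) _; exact: edist_ge0.
      apply: le_trans (expR_pow_le_shells u0) _; apply: lee_nneseries => k _.
        by move=> _; rewrite -EFinM lee_fin mulr_ge0// expR_ge0.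
      rewrite /f lee_wpmul2l// ?lee_fin ?expR_ge0//.
      rewrite mulrC -ler_pdivlMr// indicE; case: (leP (dist x)) => // le_dist.
      by rewrite mem_set.
  rewrite integral_nneseries//; apply: lee_nneseries => k _.
    by move=> _; apply: integral_ge0 => x; exact: f0.
  rewrite ge0_integralZl//=.
  - by rewrite integral_indic// /A setIAC setIid.
  by apply/measurable_EFinP; exact: measurable_indic.
rewrite -/a -lee_pdivlMl//.
apply: le_trans le_int _.
apply: (@le_trans _ _ (\sum_(0 <= k <oo) (2 * (M * C) / a * z ^+ k)%:E)%E).
  apply: lee_nneseries => k _.
    by move=> _; rewrite mule_ge0// lee_fin expR_ge0.
  apply: (le_trans (lee_wpmul2l _ (QA k))); first by rewrite lee_fin expR_ge0.
  rewrite -EFinM lee_fin.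
  have -> (u w : R) : w * (M * C * (u / a)) = M * C / a * (u * w) by ring.
  have -> (u : R) : 2 * (M * C) / a * u = M * C / a * (2 * u) by ring.
  rewrite ler_wpM2l//; first by rewrite divr_ge0 ?mulr_ge0// ltW.
  exact: expR_decay_le_geometric.
apply: le_trans (geometric_nneseries_le _ _) _.
- by rewrite divr_ge0 ?mulr_ge0// ltW.
- by rewrite z0.
- by rewrite -EFinM lee_fin [a^-1 * _]mulrCA !mulrA.
Qed.

End exponential_moment.

(** * Finite unions *)

Section unions.
Context {R : realType} {d : nat}.
Context (d_gt0 : (0 < d)%N).
Implicit Types (X Y : set 'rV[R]_d).

Lemma enorm_sub_le_ediam X x y : compact X -> X x -> X y ->
  enorm (x - y) <= ediam X.
Proof.
move=> /compact_bounded[M [Mreal XM]] Xx Xy.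
have {}XM z : X z -> `|z| <= `|M| + 1.
  by apply: XM; rewrite (le_lt_trans (ler_norm M))// ltrDl.
apply: ub_le_sup; last by exists (x, y).
exists (d%:R * (2 * (`|M| + 1))) => _ [[u v] [/= Xu Xv] <-].
apply: (le_trans (enorm_le _)); rewrite ler_wpM2l//.
apply: (le_trans (ler_normB _ _)).
by rewrite mulrDl mul1r lerD ?XM.
Qed.

(** Up to radius [ediam X] this is (X2).  Beyond it, [eball x r] contains [X],
so it meets [Y] in measure at least [m > 0], while its own measure is at most
[(2 |D|)^d]. *)
Lemma condX2_ball_share X Y (D : R) : compact X ->
  (0 < lebesgue_rV d X)%E -> measurable Y -> X `<=` Y -> condX2 X ->
  ball_share Y D X.
Proof.
move=> cX X0 mY XY [c c0 Xc]; have mX := compact_measurable_rV cX.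
have [m m0 mX_le] : exists2 m : R, 0 < m & (m%:E <= lebesgue_rV d X)%E.
  case: (lebesgue_rV d X) X0 => [m|_|]//; first by exists m.
  by exists 1 => //; rewrite leey.
have V0 : 0 < (2 * `|D|) ^+ d + 1 by rewrite ltr_wpDl// exprn_ge0// mulr_ge0.
exists (Num.min c (m / ((2 * `|D|) ^+ d + 1))).
  by rewrite lt_min c0 divr_gt0.
have mE x r : measurable (eball x r).
  by apply: closed_measurable_rV; exact: closed_eball.
move=> x r Xx /andP[r0 rD]; apply: (@le_trans _ _ (lebesgue_rV d (eball x r `&` X))).
  have [rX|Xr] := leP r (ediam X).
    have := Xc x r Xx; rewrite r0 rX => /(_ isT); apply: le_trans.
    by rewrite lee_wpmul2r// lee_fin ge_min lexx.
  rewrite (_ : eball x r `&` X = X); last first.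
    apply/setIidr => y Xy; apply: le_trans (ltW Xr).
    exact: enorm_sub_le_ediam.
  apply: le_trans mX_le; apply: (le_trans (lee_wpmul2l _ (lebesgue_rV_eball_le x r0))).
    by rewrite lee_fin le_min (ltW c0) divr_ge0// ltW.
  rewrite -EFinM lee_fin.
  apply: (@le_trans _ _ (m / ((2 * `|D|) ^+ d + 1) * ((2 * `|D|) ^+ d + 1))).
    apply: ler_pM.
    - by rewrite le_min (ltW c0) divr_ge0// ltW.
    - by rewrite exprn_ge0// mulr_ge0.
    - by rewrite ge_min lexx orbT.
    - rewrite (le_trans _ (_ : (2 * `|D|) ^+ d <= _))// ?lerDl//.
      rewrite lerXn2r ?nnegrE ?mulr_ge0// ler_wpM2l//.
      exact: le_trans rD (ler_norm _).
  by rewrite divfK// gt_eqF.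
by apply: le_measure; rewrite ?inE; [exact: measurableI|exact: measurableI|exact: setIS].
Qed.

Lemma bigcup_bigsetU (I : finType) T (F : I -> set T) :
  \bigcup_i F i = \big[setU/set0]_i F i.
Proof.
rewrite -bigcup_seq; congr (\bigcup_(i in _) _).
by apply/seteqP; split => // i _ /=; exact: mem_index_enum.
Qed.

(** Each part is compared with the whole union, at all radii up to the diameter
of the union, so that the shares can be put together by [ball_shareU]. *)
Lemma condX2_bigcup s (X : 'I_s -> set 'rV[R]_d) :
  (forall j, compact (X j) /\ (0 < lebesgue_rV d (X j))%E) ->
  (forall j, condX2 (X j)) -> condX2 (\bigcup_j X j).
Proof.
move=> cX X2; set Y := \bigcup_j X j.
have mY : measurable Y.
  apply: fin_bigcup_measurable => // j _.
  by apply: compact_measurable_rV; have [] := cX j.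
suff : ball_share Y (ediam Y) Y by [].
rewrite {3}/Y bigcup_bigsetU; apply: big_ind.
- exact: ball_share0.
- exact: ball_shareU.
- move=> j _; have [cXj Xj0] := cX j; apply: condX2_ball_share => //.
  by move=> x Xjx; exists j.
Qed.

Lemma edist_antimono (S T : set 'rV[R]_d) x : S `<=` T -> S !=set0 ->
  edist x T <= edist x S.
Proof.
move=> ST [z Sz]; apply: lb_le_inf; first by exists (enorm (x - z)), z.
move=> _ [w Sw <-]; apply: ge_inf; last by exists w => //; exact: ST.
by exists 0 => _ [u _ <-]; exact: sqrtr_ge0.
Qed.

Lemma ge0_integral_setU_le (mu : {measure set 'rV[R]_d -> \bar R}) X Y
    (f : 'rV[R]_d -> \bar R) : measurable X -> measurable Y ->
  measurable_fun (X `|` Y) f -> (forall x, 0 <= f x)%E ->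
  (\int[mu]_(x in X `|` Y) f x <= \int[mu]_(x in X) f x + \int[mu]_(x in Y) f x)%E.
Proof.
move=> mX mY mf f0.
have XYE : X `|` Y = X `|` (Y `\` X) by rewrite setDE setUIr setUv setIT.
rewrite XYE in mf *; rewrite ge0_integral_setU//; first last.
- by rewrite disj_set2E setDIK.
- exact: measurableD.
apply: leeD => //; apply: ge0_subset_integral => //; first exact: measurableD.
by apply: measurable_funS mf; [exact: measurableU (measurableD mY mX)|rewrite -XYE].
Qed.

(** The distance to the complement of the union dominates the distance to the
complement of each part.  Compactness is used to know that the complement of
the union is not empty: the infimum over the empty set is 0 by convention. *)
Lemma condAU (Q : probability 'rV[R]_d R) X Y : compact X -> compact Y ->
  condA Q X -> condA Q Y -> condA Q (X `|` Y).
Proof.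
move=> cX cY AX AY; have mX := compact_measurable_rV cX.
have mY := compact_measurable_rV cY.
have nXY := compact_setC_nonempty d_gt0 (compactU cX cY).
pose f (Z : set 'rV[R]_d) (L : R) x : \bar R :=
  (expR (- (L * edist x (~` Z) ^+ d)))%:E.
have f0 Z L x : (0 <= f Z L x)%E by rewrite lee_fin expR_ge0.
have mf Z L D : measurable D -> measurable_fun D (f Z L).
  by move=> mD; exact: measurable_exp_edist.
have fS Z L x : 0 < L -> Z `<=` X `|` Y -> (f (X `|` Y) L x <= f Z L x)%E.
  move=> L0 ZXY; rewrite lee_fin ler_expR lerN2 ler_wpM2l ?(ltW L0)//.
  apply: lerXn2r; rewrite ?nnegrE; [exact: edist_ge0|exact: edist_ge0|].
  by apply: edist_antimono => //; exact: subsetC.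
apply: (@le_lt_trans _ _ (ereal_sup [set (L `^ d%:R^-1)%:E *
      \int[Q]_(x in X) f X L x | L in [set L : R | (0 < L)%R]] +
    ereal_sup [set (L `^ d%:R^-1)%:E *
      \int[Q]_(x in Y) f Y L x | L in [set L : R | (0 < L)%R]])%E).
  apply: ge_ereal_sup => _ [L /= L0 <-].
  have L_ge0 : (0 <= (L `^ d%:R^-1)%:E)%E by rewrite lee_fin powR_ge0.
  have intXY : (\int[Q]_(x in X `|` Y) f (X `|` Y)%classic L x <=
      \int[Q]_(x in X) f X L x + \int[Q]_(x in Y) f Y L x)%E.
    apply: (@le_trans _ _ (\int[Q]_(x in X) f (X `|` Y)%classic L x +
        \int[Q]_(x in Y) f (X `|` Y)%classic L x)%E).
      by apply: ge0_integral_setU_le => //; apply: mf; exact: measurableU.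
    apply: leeD; apply: ge0_le_integral => //.
    - exact: mf.
    - exact: mf.
    - by move=> x _; exact: fS.
    - exact: mf.
    - exact: mf.
    - by move=> x _; exact: fS.
  apply: (le_trans (lee_wpmul2l L_ge0 intXY)).
  rewrite ge0_muleDr; [|exact: integral_ge0|exact: integral_ge0].
  by apply: leeD; apply: ereal_sup_ubound; exists L.
by apply: lte_add_pinfty; [exact: AX|exact: AY].
Qed.

Lemma condA0 (Q : probability 'rV[R]_d R) : condA Q set0.
Proof.
apply: (@le_lt_trans _ _ 0%E); last exact: ltry.
by apply: ge_ereal_sup => _ [L _ <-]; rewrite integral_set0 mule0.
Qed.

Lemma condA_bigcup (Q : probability 'rV[R]_d R) s (X : 'I_s -> set 'rV[R]_d) :
  (forall j, compact (X j)) -> (forall j, condA Q (X j)) ->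
  condA Q (\bigcup_j X j).
Proof.
move=> cX AX; suff [] : compact (\bigcup_j X j) /\ condA Q (\bigcup_j X j) by [].
rewrite bigcup_bigsetU.
apply: (big_ind (fun A => compact A /\ condA Q A)) => [|A B [cA AA] [cB AB]|j _].
- by split; [exact: compact0|exact: condA0].
- by split; [exact: compactU|exact: condAU].
- by split; [exact: cX|exact: AX].
Qed.

End unions.

(** * Cones in convex bodies *)

Section convex_cone.
Context {R : realType} {d : nat}.
Implicit Types (X : set 'rV[R]_d) (p : 'rV[R]_d).

(** With [v = 0] the cone condition says that [X] contains small balls around
the points near [p]. *)
Lemma interior_inner_cone X p : X° p -> inner_cone X p.
Proof.
move=> /nbhs_ballP[r /= r0 prX].
have r20 : 0 < r / 2 by rewrite divr_gt0.
exists (ball p (r / 2)), 0, 1, (r / 2); split => //; first exact: nbhsx_ballx.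
move=> x t _ px /andP[_ tr] y; rewrite scaler0 addr0 mul1r => xy.
by apply: prX; rewrite [r]splitr; apply: ball_triangle px _; exact: le_ball xy.
Qed.

Lemma convex_set_segment X x y (t : R) : convex_set X -> X x -> X y ->
  0 <= t <= 1 -> X ((1 - t) *: x + t *: y).
Proof.
move=> cX Xx Xy /andP[t0 t1].
have := cX y x (Itv01 t0 t1); rewrite !inE => /(_ Xy Xx).
by rewrite addrC.
Qed.

(** A point [y] of the cone ball is a convex combination of [x] and of a point
[b] close to the centre [a] of a ball contained in [X]: moving from [p] to [x]
and from the axis to [y] changes [a] by less than the radius. *)
Lemma convex_inner_cone X p : convex_set X -> X° !=set0 -> inner_cone X p.
Proof.
move=> cX [a /nbhs_ballP[r /= r0 arX]].
have r20 : 0 < r / 2 by rewrite divr_gt0.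
exists (ball p (r / 2)), (a - p), (r / 2), 1; split => //; first exact: nbhsx_ballx.
move=> x t Xx px /andP[]; rewrite le_eqVlt => /predU1P[<- _ y|t0 t1 y].
  by rewrite mulr0 => -[]; rewrite ltxx.
rewrite -ball_normE /= => xy.
pose b := a + (x - p) + t^-1 *: (y - (x + t *: (a - p))).
rewrite (_ : y = (1 - t) *: x + t *: b); last first.
  by apply/rowP => i; rewrite !mxE; field; rewrite gt_eqF.
apply: convex_set_segment => //; last by rewrite ltW.
apply: arX; rewrite -ball_normE /= /b opprD addrA opprD addrA subrr sub0r -opprD normrN.
rewrite [r]splitr; apply: le_lt_trans (ler_normD _ _) _; apply: ltrD.
  by rewrite distrC; move: px; rewrite -ball_normE.
rewrite normrZ ger0_norm ?invr_ge0 1?ltW// distrC.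
by rewrite mulrC ltr_pdivrMr.
Qed.

End convex_cone.

(** * Strict monotonicity of a C^1 coordinate *)

Section C1_functions.
Context {R : realType} {d : nat}.
Implicit Types (f g : 'rV[R]_d -> 'rV[R]_d) (x p v : 'rV[R]_d) (l : 'I_d).

(** Differentiating [f \o g = id] at [f p] shows that [df(p)] is onto; [v] is
the image under [dg(f p)] of the basis vector of index [l]. *)
Lemma C1_diffeo_transversal U V f g p l : C1_diffeo U V f g -> U p ->
  exists v, (v *m jacobian f p) ord0 l = 1.
Proof.
move=> [oU oV UV VU [C1f C1g]] Up.
have [Vfp gfp] := UV p Up.
have [df _] := C1f p Up; have [dg _] := C1g (f p) Vfp.
pose e : 'rV[R]_d := delta_mx ord0 l.
exists ('d g (f p) e); rewrite /jacobian mul_rV_lin1.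
have dfg : differentiable f (g (f p)) by rewrite gfp.
have : 'D_e (f \o g) (f p) = e.
  rewrite -[RHS](derive_id (f p)); apply: near_eq_derive.
  apply: filterS (open_nbhs_nbhs (conj oV Vfp)) => y Vy.
  exact: (VU y Vy).2.
rewrite deriveE; last exact: differentiable_comp.
have dfgE := diff_comp dg dfg; rewrite gfp in dfgE.
have dfgeE : 'd (f \o g) (f p) e = 'd f p ('d g (f p) e).
  exact: (congr1 (fun h : 'rV[R]_d -> 'rV[R]_d => h e) dfgE).
move=> /(etrans (esym dfgeE)) dfge.
by rewrite dfge /e mxE !eqxx.
Qed.

Lemma derive_along_line f x u l t : differentiable f (x + t *: u) ->
  is_derive t 1 (fun s : R => f (x + s *: u) ord0 l)
    ((u *m jacobian f (x + t *: u)) ord0 l).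
Proof.
move=> df.
have dF := diff_derivable df (v := u).
have /derivable_mxP/(_ ord0 l) dFl := dF.
have E : (fun h : R => h^-1 *: (((fun s : R => f (x + s *: u) ord0 l) \o
   shift t) (h *: 1) - f (x + t *: u) ord0 l)) =
   (fun h : R => h^-1 *: (((fun z => f z ord0 l) \o
   shift (x + t *: u)) (h *: u) - f (x + t *: u) ord0 l)).
  apply/funext => h /=; congr (_ *: (f _ ord0 l - _)).
  by rewrite scalerDl [h%:A]mulr1 addrCA.
apply: DeriveDef.
  by rewrite /derivable E.
rewrite -deriveEjacobian// derive_mx// mxE.
by rewrite /derive E.
Qed.

(** The expression [c * (w *m jacobian f x) ord0 l] is jointly continuous in
[(w, x)], and positive at [(v, p)]. *)
Lemma C1_near_transversal f p v l (c : R) :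
  {for p, continuous (jacobian f)} -> 0 < c * (v *m jacobian f p) ord0 l ->
  exists2 e : R, 0 < e & forall w x, `|v - w| < e -> `|p - x| < e ->
    0 < c * (w *m jacobian f x) ord0 l.
Proof.
move=> cJ pos.
pose F (z : 'rV[R]_d * 'rV[R]_d) : R :=
  c * (z.1 *m jacobian f z.2) ord0 l.
have cF : {for (v, p), continuous F}.
  rewrite (_ : F = fun z => c * \sum_i z.1 ord0 i * jacobian f z.2 i l); last first.
    by apply/funext => z; rewrite /F mxE.
  apply: cvgM; first exact: cvg_cst.
  apply: (@cvg_big _ _ +%R 0); first exact: add_continuous.
  move=> i _; apply: cvgM.
    apply: (@continuous_comp _ _ _ fst (fun w : 'rV[R]_d => w ord0 i)).
      exact: cvg_fst.
    exact: coord_continuous.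
  apply: (@continuous_comp _ _ _ snd (fun x => jacobian f x i l)).
    exact: cvg_snd.
  apply: (@continuous_comp _ _ _ (jacobian f) (fun M : 'M[R]_d => M i l)) => //.
  exact: coord_continuous.
have /nbhs_ballP[e /= e0 eF] : nbhs (v, p) (F @^-1` [set r : R | 0 < r]).
  apply: cF; apply: open_nbhs_nbhs; split => //; exact: open_gt.
exists e; first exact: e0.
move=> w x vw px; have : ball (v, p) e (w, x) by split; rewrite -ball_normE.
by move=> /eF.
Qed.

(** Write [y = x + t w] with [w] close to [v], and apply the mean value theorem
on the segment from [x] to [y]: the derivative there is positive by
[C1_near_transversal].  The factor [c] is the orientation of the coordinate. *)
Lemma C1_increasing_in_cone f p v l (c : R) U : nbhs p U ->
  (forall x, U x -> differentiable f x) ->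
  {for p, continuous (jacobian f)} -> 0 < c * (v *m jacobian f p) ord0 l ->
  exists e r T : R, [/\ 0 < e, 0 < r, 0 < T & forall x t y, `|p - x| < r ->
    0 <= t <= T -> ball (x + t *: v) (e * t) y ->
    U y /\ c * f x ord0 l < c * f y ord0 l].
Proof.
move=> /nbhs_ballP[r1 /= r10 pU] dfU cJ pos.
have [e e0 eJ] := C1_near_transversal cJ pos.
pose r := Num.min r1 e.
have r0 : 0 < r by rewrite lt_min r10.
(* For [x] within [r / 2] of [p] and [|w| < |v| + e], the segment from [x] to
   [x + T w] stays within [r] of [p]. *)
pose T := r / 2 / (`|v| + e).
have ve0 : 0 < `|v| + e by rewrite ltr_wpDl.
have T0 : 0 < T by rewrite !divr_gt0.
exists e, (r / 2), T; split => //; first by rewrite divr_gt0.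
move=> x t y px /andP[t0 tT] xy.
have {t0}t0 : 0 < t by case: xy => + _; rewrite pmulr_rgt0.
move: xy; rewrite -ball_normE /= => xy.
pose w := t^-1 *: (y - x).
have wy : y = x + t *: w.
  by rewrite /w scalerA mulfV ?gt_eqF// scale1r addrC subrK.
have vw : `|v - w| < e.
  rewrite (_ : v - w = t^-1 *: (x + t *: v - y)); last first.
    by apply/rowP => i; rewrite !mxE; field; rewrite gt_eqF.
  by rewrite normrZ ger0_norm ?invr_ge0 1?ltW// mulrC ltr_pdivrMr.
have w_lt : `|w| < `|v| + e.
  rewrite (_ : w = v - (v - w)); last by rewrite opprB addrC subrK.
  by apply: le_lt_trans (ler_normB _ _) _; rewrite ltrD2l.
have pseg s : 0 <= s <= t -> `|p - (x + s *: w)| < r.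
  move=> /andP[s0 st]; rewrite opprD addrA [r]splitr.
  apply: le_lt_trans (ler_normB _ _) _; apply: ltr_leD => //.
  rewrite normrZ ger0_norm//; apply: (@le_trans _ _ (T * (`|v| + e))).
    by apply: ler_pM => //; [exact: le_trans st tT|exact: ltW].
  by rewrite divfK// gt_eqF.
have Useg s : 0 <= s <= t -> U (x + s *: w).
  move=> st; apply: pU; rewrite -ball_normE /=; apply: lt_le_trans (pseg s st) _.
  by rewrite ge_min lexx.
split; first by rewrite wy; apply: Useg; rewrite (ltW t0) lexx.
pose h : R -> R := fun s => f (x + s *: w) ord0 l.
pose h' : R -> R := fun s => (w *m jacobian f (x + s *: w)) ord0 l.
have dh (s : R) : s \in `[0, t] -> is_derive s 1 h (h' s).
  by rewrite in_itv /= => st; apply: derive_along_line; exact/dfU/Useg.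
have dh_oo (s : R) : s \in `]0, t[ -> is_derive s 1 h (h' s).
  by move=> st; apply: dh; exact: subset_itv_oo_cc st.
have ch : {within `[0, t], continuous h}.
  apply: derivable_within_continuous => s st.
  exact: (@ex_derive _ _ _ _ _ _ _ (dh s st)).
have [s sI hE] := MVT t0 dh_oo ch.
have -> : f x ord0 l = h 0 by rewrite /h scale0r addr0.
have -> : f y ord0 l = h t by rewrite /h -wy.
rewrite -subr_gt0 -mulrBr hE subr0 mulrA; apply: mulr_gt0 t0; apply: eJ vw _.
have st : 0 <= s <= t.
  by move: sI; rewrite in_itv /= => /andP[/ltW-> /ltW->].
apply: lt_le_trans (pseg s st) _.
by rewrite ge_min lexx orbT.
Qed.

End C1_functions.

(** * Cones at a C^1 boundary *)

Section C1_boundary.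
Context {R : realType} {d : nat}.
Implicit Types (X C : set 'rV[R]_d) (p : 'rV[R]_d).

Lemma closed_nboundary_interior X x : closed X -> X x -> ~ boundary X x -> X° x.
Proof.
by move=> /closure_id cX Xx nbx; apply: contrapT => nX0; apply: nbx; split;
  rewrite -?cX.
Qed.

(** Off its boundary a closed set splits the space into two open sets, its
interior and its complement, and the path is connected. *)
Lemma path_avoiding_boundary X (h : R -> 'rV[R]_d) : closed X ->
  {within `[0, 1], continuous h} ->
  (forall s, 0 <= s <= 1 -> ~ boundary X (h s)) ->
  X (h 0) -> X (h 1).
Proof.
move=> clX ch hX Xh0.
have sep : separated X° (~` X).
  split; last by rewrite closure_setC setICr.
  apply/seteqP; split => // x [+ nXx]; apply: contra_not nXx => x0.
  rewrite ((closure_id X).1 clX); apply: closure_subset x0.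
  exact: interior_subset.
have I0 : (0 : R) \in `[0, 1] by rewrite in_itv /= lexx ler01.
have I1 : (1 : R) \in `[0, 1] by rewrite in_itv /= lexx ler01.
have [||hI|hI] := connected_subset sep (C := h @` `[0, 1]).
- move=> _ [s /= + <-]; rewrite in_itv /= => sI.
  have [Xhs|] := pselect (X (h s)); last by right.
  by left; apply: closed_nboundary_interior => //; exact: hX.
- by apply: connected_continuous_connected ch; exact: segment_connected.
- by apply: interior_subset; apply: hI; exists 1.
- by exfalso; apply: (hI (h 0)) => //; exists 0.
Qed.

(** The images of segments are paths that avoid the boundary. *)
Lemma image_of_convex_one_side X C (g : 'rV[R]_d -> 'rV[R]_d) : closed X ->
  (forall y z s, C y -> C z -> 0 <= s <= 1 -> C (y + s *: (z - y))) ->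
  (forall y, C y -> {for y, continuous g}) ->
  (forall y, C y -> ~ boundary X (g y)) ->
  (forall y, C y -> X (g y)) \/ (forall y, C y -> ~ X (g y)).
Proof.
move=> clX segC cg gC.
have [[y [Cy Xgy]]|nC] := pselect (exists y, C y /\ X (g y)); last first.
  by right => y Cy Xgy; apply: nC; exists y.
left => z Cz.
pose h s := g (y + s *: (z - y)).
have hC s : 0 <= s <= 1 -> C (y + s *: (z - y)) by exact: segC.
have -> : g z = h 1 by rewrite /h scale1r addrC subrK.
apply: path_avoiding_boundary => //.
- apply: continuous_in_subspaceT => s; rewrite inE /= in_itv /= => sI.
  apply: (@continuous_comp _ _ _ (fun s : R => y + s *: (z - y)) g).
    apply: (@continuousD _ _ _ (cst y) (fun s : R => s *: (z - y))).
      exact: cst_continuous.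
    exact: scalel_continuous.
  exact/cg/hC.
- by move=> s /hC; exact: gC.
- by rewrite /h scale0r addr0.
Qed.

Definition half_ball (l : 'I_d) (c : R) p (r : R) : set 'rV[R]_d :=
  ball p r `&` [set y | 0 < c * y ord0 l].

Lemma half_ball_convex l c p r y z s : half_ball l c p r y ->
  half_ball l c p r z -> 0 <= s <= 1 -> half_ball l c p r (y + s *: (z - y)).
Proof.
rewrite /half_ball -ball_normE => -[/= py yl] [/= pz zl] /andP[s0 s1].
have s1' : 0 <= 1 - s by rewrite subr_ge0.
split => /=.
  rewrite (_ : p - _ = (1 - s) *: (p - y) + s *: (p - z)); last first.
    by apply/rowP => i; rewrite !mxE; ring.
  pose m := Num.max `|p - y| `|p - z|.
  apply: (@le_lt_trans _ _ ((1 - s) * m + s * m)); last first.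
    by rewrite -mulrDl subrK mul1r gt_max py.
  apply: le_trans (ler_normD _ _) _; rewrite !normrZ !ger0_norm//.
  by apply: lerD; rewrite ler_wpM2l// le_max lexx ?orbT.
pose m := Num.min (c * y ord0 l) (c * z ord0 l).
rewrite !mxE (_ : c * _ = (1 - s) * (c * y ord0 l) + s * (c * z ord0 l)).
  apply: (@lt_le_trans _ _ ((1 - s) * m + s * m)).
    by rewrite -mulrDl subrK mul1r lt_min yl.
  by apply: lerD; rewrite ler_wpM2l// ge_min lexx ?orbT.
by ring.
Qed.

(** The sign [c] tells on which side of the hypersurface [X] lies. On that side
the last chart coordinate, multiplied by [c], is nonnegative on [X] near [p],
and a point near [p] where it is positive belongs to [X]. *)
Lemma C1_boundary_inner_cone X O p : (0 < d)%N -> closed X -> open O ->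
  X = closure O -> C1_submanifold d.-1 (boundary X) -> X p -> inner_cone X p.
Proof.
move=> d0 clX oO XO smX Xp.
have [bp|nbp] := pselect (boundary X p); last first.
  by apply: interior_inner_cone; exact: closed_nboundary_interior.
have [U [V [f [g [Up fgUV fS]]]]] := smX p bp.
have [oU oV UV VU [C1f C1g]] := fgUV.
have ld : (d.-1 < d)%N by rewrite prednK.
pose l : 'I_d := Ordinal ld.
have OX : O `<=` X° by rewrite -open_subsetE// XO; exact: subset_closure.
have bE x : U x -> boundary X x <-> f x ord0 l = 0.
  move=> Ux; split=> [bx|fx0].
    have [_ /(_ l)] : (V `&` [set y | forall i : 'I_d,
        (d.-1 <= i)%N -> y ord0 i = 0]) (f x).
      by rewrite -fS; exists x.
    exact.
  have : (f @` (U `&` boundary X)) (f x).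
    rewrite fS; split; first by have [] := UV x Ux.
    move=> i di; rewrite (_ : i = l)//; apply/val_inj => /=.
    by apply/eqP; rewrite eqn_leq di andbT -ltnS prednK.
  move=> [z [Uz bz] fzx]; have [_ <-] := UV x Ux; rewrite -fzx.
  by have [_ ->] := UV z Uz.
have [Vfp gfp] := UV p Up.
have /nbhs_ballP[r /= r0 rV] : nbhs (f p) V by exact: open_nbhs_nbhs.
pose half (c : R) := half_ball l c (f p) r.
have halfV c : half c `<=` V by move=> y [/rV].
have half_side c :
    (forall y, half c y -> X (g y)) \/ (forall y, half c y -> ~ X (g y)).
  apply: image_of_convex_one_side => //.
  - by move=> y z s; exact: half_ball_convex.
  - by move=> y /halfV Vy; apply: differentiable_continuous; have [] := C1g y Vy.
  - move=> y [/rV Vy yl]; have [Ugy fgy] := VU y Vy.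
    move=> /(bE _ Ugy); rewrite fgy => yl0.
    by move: yl; rewrite /= yl0 mulr0 ltxx.
pose W := U `&` f @^-1` ball (f p) r.
have nW : nbhs p W.
  apply: filterI; first exact: open_nbhs_nbhs.
  have [/differentiable_continuous cf _] := C1f p Up.
  by apply: cf; exact: nbhsx_ballx.
have WE x : W x -> [\/ boundary X x, half 1 (f x) | half (-1) (f x)].
  move=> [Ux fx]; have := bE x Ux; have [/[swap] H|H _|H _] := ltgtP (f x ord0 l) 0.
  - by constructor 3; split => //=; rewrite mulN1r oppr_gt0.
  - by constructor 2; split => //=; rewrite mul1r.
  - by constructor 1; apply/bE.
have gW x : W x -> g (f x) = x by move=> [Ux _]; have [] := UV x Ux.
have bX x : boundary X x -> X x by move=> [+ _]; rewrite -(closure_id _).1.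
have [c [c0 Xge0 gt0X]] : exists c : R, [/\ c != 0,
    (forall x, W x -> X x -> 0 <= c * f x ord0 l) &
    (forall x, W x -> 0 < c * f x ord0 l -> X x)].
  have n1 : (-1 : R) != 0 by rewrite oppr_eq0 oner_eq0.
  (* Both halves in [X] would make [p] an interior point; both halves outside [X]
     would make [X], hence [O], part of the boundary near [p], although [O] lies
     in the interior. *)
  have [Xp1|nXp1] := half_side 1; have [Xm1|nXm1] := half_side (-1).
  - exfalso; case: bp => _; apply; apply: filterS nW => x Wx.
    by have [/bX|/Xp1|/Xm1] := WE x Wx; rewrite ?gW.
  - exists 1; split => //[x Wx Xx|x [Ux fx] xl].
      have [/bE|[]|/nXm1] := WE x Wx.
      - by case: Wx => Ux _ /(_ Ux) ->; rewrite mulr0.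
      - by move=> _ /ltW.
      - by rewrite gW.
    by rewrite -(gW x)//; apply: Xp1.
  - exists (-1); split => //[x Wx Xx|x [Ux fx] xl].
      have [/bE|/nXp1|[]] := WE x Wx.
      - by case: Wx => Ux _ /(_ Ux) ->; rewrite mulr0.
      - by rewrite gW.
      - by move=> _ /ltW.
    by rewrite -(gW x)//; apply: Xm1.
  - exfalso; move: Xp; rewrite XO => /(_ _ nW)[x [Ox Wx]].
    have X0x := OX _ Ox; have Xx := interior_subset X0x.
    have [[_]|/nXp1|/nXm1] := WE x Wx; first exact.
    - by rewrite gW.
    - by rewrite gW.
have [v vl] := C1_diffeo_transversal l fgUV Up.
have pos : 0 < c * ((c *: v) *m jacobian f p) ord0 l.
  by rewrite -scalemxAl mxE vl mulr1 -expr2 exprn_even_gt0.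
have dW x : W x -> differentiable f x by move=> [Ux _]; have [] := C1f x Ux.
have cJ : {for p, continuous (jacobian f)} by have [] := C1f p Up.
have [e [r2 [T [e0 r20 T0 incr]]]] := C1_increasing_in_cone nW dW cJ pos.
exists (W `&` ball p r2), (c *: v), e, T; split => //.
  by apply: filterI => //; exact: nbhsx_ballx.
move=> x t Xx [Wx px] tT y xy.
have [|Wy fxy] := incr x t y _ tT xy; first by move: px; rewrite -ball_normE.
by apply: gt0X => //; apply: le_lt_trans fxy; exact: Xge0.
Qed.

End C1_boundary.

(** * The theorem *)

Theorem theorem5 (R : realType) (d : nat) (d_gt0 : (0 < d)%N)
    (Q : probability 'rV[R]_d R) (q : 'rV[R]_d -> R)
    (Q_density : is_density Q q)
    (q_bounded : exists M : R, forall x, q x <= M) :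
  (forall X : set 'rV[R]_d,
     compact X -> (0 < lebesgue_rV d X)%E ->
     (convex_set X /\ X° !=set0) \/
     ((exists O : set 'rV[R]_d, [/\ open O, bounded_set O & X = closure O]) /\
      C1_submanifold d.-1 (boundary X)) ->
     condX2 X /\ condA Q X) /\
  (forall (s : nat) (X : 'I_s -> set 'rV[R]_d),
     (forall j, compact (X j) /\ (0 < lebesgue_rV d (X j))%E) ->
     ((forall j, condX2 (X j)) -> condX2 (\bigcup_j X j)) /\
     ((forall j, condA Q (X j)) -> condA Q (\bigcup_j X j))).
Proof.
have cone_X2A X : compact X -> (forall p, X p -> inner_cone X p) ->
    condX2 X /\ condA Q X.
  move=> cX coneX; split; first exact: inner_cone_X2.
  apply: thin_collar_condA Q_density q_bounded (compact_measurable_rV cX) _ => //.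
  exact: inner_cone_thin_collar.
split=> [X cX _ caseX|s X cX].
  case: caseX => [[convX X0]|[[G [oG _ XG]] smX]].
  - by apply: cone_X2A => // p _; exact: convex_inner_cone.
  - apply: cone_X2A => // p Xp.
    by apply: C1_boundary_inner_cone oG XG smX Xp => //; exact: compact_closed.
split; first exact: condX2_bigcup.
by apply: condA_bigcup => // j; have [] := cX j.
Qed.
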